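(* Let $E\to M$ be a vector bundle. Any twisted omni-Lie algebroid of $E$ is isomorphic to the standard omni-Lie algebroid $\mathcal E=\mathfrak DE\oplus\mathfrak JE$. That is, for every $\Theta\in\Gamma(\mathrm{Hom}(\wedge^3\mathfrak DE,E)_{\mathfrak JE})$ with $\mathbf d\Theta=0$, the $\Theta$-twisted omni-Lie algebroid is isomorphic, as an $E$-Courant algebroid, to the omni-Lie algebroid $\mathcal E$.
   Context: **Bundles.** $\mathfrak DE$ is the gauge Lie algebroid of $E$: its sections are the $\mathbb R$-linear $\mathfrak d:\Gamma(E)\to\Gamma(E)$ for which there is a vector field $j(\mathfrak d)$ with $\mathfrak d(fu)=f\mathfrak d(u)+j(\mathfrak d)(f)u$; bracket $[\cdot,\cdot]_{\mathfrak D}$ = commutator, anchor $j$. The first jet bundle $\mathfrak JE$ is regarded as $\{\nu\in\mathrm{Hom}(\mathfrak DE,E):\nu(\Psi)=\Psi(\nu(\mathrm{Id}_E))\ \forall\Psi\in\mathfrak{gl}(E)\}$, the jet $[u]_m$ corresponding to $\mathfrak d\mapsto\mathfrak d(u)(m)$. Write $\langle\mu,\mathfrak d\rangle_E=\langle\mathfrak d,\mu\rangle_E=\mu(\mathfrak d)$, and $\mathbf d:\Gamma(E)\to\Gamma(\mathfrak JE)$, $(\mathbf du)(\mathfrak d)=\mathfrak d(u)$. The Lie derivative on $\Gamma(\mathfrak JE)$ is $\langle\mathcal L_{\mathfrak d}\mu,\mathfrak d'\rangle_E=\mathfrak d\langle\mu,\mathfrak d'\rangle_E-\langle\mu,[\mathfrak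 d,\mathfrak d']_{\mathfrak D}\rangle_E$. $\mathrm{Hom}(\wedge^k\mathfrak DE,E)_{\mathfrak JE}$ ($k\ge2$) is the bundle of those $\mu\in\mathrm{Hom}(\wedge^k\mathfrak DE,E)$ for which $\mu(\mathfrak d_1,\dots,\mathfrak d_{k-1},\cdot)\in\mathfrak JE\subset\mathrm{Hom}(\mathfrak DE,E)$ for all $\mathfrak d_i$; $\mathbf d$ also denotes the Chevalley–Eilenberg coboundary of the Lie algebroid $\mathfrak DE$ with coefficients in its tautological representation on $E$. **Omni-Lie algebroid.** $\mathcal E=\mathfrak DE\oplus\mathfrak JE$ with anchor $\rho$ the projection to $\mathfrak DE$, standard pairing $(\mathfrak d+\mu,\mathfrak r+\nu)_E=\tfrac12(\langle\mathfrak d,\nu\rangle_E+\langle\mathfrak r,\mu\rangle_E)$ and standard bracket $\{\mathfrak d+\mu,\mathfrak r+\nu\}=[\mathfrak d,\mathfrak r]_{\mathfrak D}+\mathcal L_{\mathfrak d}\nu-\mathcal L_{\mathfrak r}\mu+\mathbf d\langle\mu,\mathfrak r\rangle_E$. **Twist.** For $\Theta\in\Gamma(\mathrm{Hom}(\wedge^3\mathfrak DE,E)_{\mathfrak JE})$, write $\Theta(\mathfrak d\wedge\mathfrak r)\in\Gamma(\mathfrak JE)$ for $\langle\Theta(\mathfrak d\wedge\mathfrak r),\mathfrak t\rangle_E=\Theta(\mathfrak d,\mathfrak r,\mathfrak t)$, and put $\{\mathfrak d+\mu,\mathfrak r+\nu\}_\Theta=\{\mathfrak d+\mu,\mathfrak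 r+\nu\}+\Theta(\mathfrak d\wedge\mathfrak r)$. When $\mathbf d\Theta=0$, $\mathfrak DE\oplus\mathfrak JE$ with this bracket, the standard pairing and the same anchor is an $E$-Courant algebroid, called the $\Theta$-twisted omni-Lie algebroid. An isomorphism between two such structures is a vector bundle isomorphism (covering $\mathrm{Id}_E$) that preserves the $E$-valued pairings and the brackets and is compatible with the anchors. *)

(* Defs.v *)
From HB Require Import structures.
From mathcomp Require Import all_boot all_order all_algebra.
From mathcomp Require Import all_classical all_reals.
From mathcomp Require Import topology normedtype derive.
From mathcomp Require Import ring.

Set Implicit Arguments.
Unset Strict Implicit.
Unset Printing Implicit Defensive.

Import Order.TTheory GRing.Theory Num.Theory numFieldNormedType.Exports.
Local Open Scope classical_set_scope.
Local Open Scope ring_scope.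

(** Real C^k functions on a subset U (open in practice) of R^n: all iterated
    directional derivatives of order at most k exist and are continuous on U.
    The values of f outside U are irrelevant when U is open. *)
Fixpoint Ck (R : realType) (n k : nat) (U : set 'rV[R]_n) (f : 'rV[R]_n -> R)
    {struct k} : Prop :=
  (forall x, U x -> {for x, continuous f}) /\
  if k is k'.+1 then
    forall v : 'rV[R]_n, (forall x, U x -> derivable f x v) /\
                         Ck k' U (fun x => 'D_v f x)
  else True.

Definition Coo (R : realType) (n : nat) (U : set 'rV[R]_n)
  (f : 'rV[R]_n -> R) : Prop := forall k, Ck k U f.

Section CkTheory.
Variables (R : realType) (n : nat) (U : set 'rV[R]_n).
Hypothesis oU : open U.
Implicit Types (f g : 'rV[R]_n -> R).

Lemma Ck_eq k f g : (forall x, U x -> f x = g x) -> Ck k U f -> Ck k U g.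
Proof.
have near_eq (p q : 'rV[R]_n -> R) x : (forall y, U y -> p y = q y) -> U x ->
    {near x, p =1 q}.
  move=> pq Ux; have Unx : nbhs x U by exact: open_nbhs_nbhs.
  by apply: filterS Unx => y; exact: pq.
have ctg (p q : 'rV[R]_n -> R) : (forall y, U y -> p y = q y) ->
    (forall x, U x -> {for x, continuous p}) ->
    forall x, U x -> {for x, continuous q}.
  move=> pq cp x Ux; rewrite /prop_for /continuous_at -(pq _ Ux).
  apply: cvg_trans (cp x Ux).
  exact: (@near_eq_cvg _ _ (nbhs x) _ p q (near_eq p q x pq Ux)).
elim: k f g => [|k IH] f g fg /= [cf df]; split => //; try exact: ctg cf.
move=> v; have [dfv Cf] := df v; split.
  by move=> x Ux; apply: near_eq_derivable (dfv x Ux); exact: near_eq.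
by apply: IH Cf => x Ux; apply: near_eq_derive;
  exact: (near_eq f g x fg Ux).
Qed.

Lemma Ck_cst k (c : R) : Ck k U (fun=> c).
Proof.
elim: k c => [|k IH] c; split => //; try by move=> x _; exact: cst_continuous.
move=> v; split; first by move=> x _; exact: derivable_cst.
apply: (Ck_eq (f := fun=> 0)); last exact: IH.
by move=> x _; rewrite derive_cst.
Qed.

Lemma CkS k f : Ck k.+1 U f -> Ck k U f.
Proof.
elim: k f => [|k IH] f [cf df]; split => // v.
by have [dv Cv] := df v; split => //; exact: IH.
Qed.

Lemma CkD k f g : Ck k U f -> Ck k U g -> Ck k U (fun x => f x + g x).
Proof.
elim: k f g => [|k IH] f g [cf df] [cg dg]; split => //;
  try by move=> x Ux; apply: continuousD; [exact: cf|exact: cg].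
move=> v; have [df1 Cf] := df v; have [dg1 Cg] := dg v; split.
  by move=> x Ux; apply: derivableD; [exact: df1|exact: dg1].
by apply: Ck_eq (IH _ _ Cf Cg) => x Ux; apply/esym/deriveD;
  [exact: df1|exact: dg1].
Qed.

Lemma CkM k f g : Ck k U f -> Ck k U g -> Ck k U (fun x => f x * g x).
Proof.
elim: k f g => [|k IH] f g Cf Cg; have [cf df] := Cf; have [cg dg] := Cg;
  split => //; try by move=> x Ux; apply: continuousM; [exact: cf|exact: cg].
move=> v; have [df1 Df] := df v; have [dg1 Dg] := dg v; split.
  by move=> x Ux; apply: derivableM; [exact: df1|exact: dg1].
apply: Ck_eq (CkD (IH _ _ (CkS Cf) Dg) (IH _ _ (CkS Cg) Df)) => x Ux.
by apply/esym/deriveM; [exact: df1|exact: dg1].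
Qed.

End CkTheory.

(** Smooth manifolds of dimension n, given by a smooth atlas.  [chart a] and
    [chart_inv a] are total functions, meaningful only on [chart_dom a] and on
    its image. *)
Record manifold (R : realType) (n : nat) := Manifold {
  mfd_space :> topologicalType;
  mfd_hausdorff : hausdorff_space mfd_space;
  mfd_second_countable : @second_countable mfd_space;
  chart_idx : Type;
  chart_dom : chart_idx -> set mfd_space;
  chart : chart_idx -> mfd_space -> 'rV[R]_n;
  chart_inv : chart_idx -> 'rV[R]_n -> mfd_space;
  chart_dom_open : forall a, open (chart_dom a);
  chart_cover : forall m, exists a, chart_dom a m;
  chart_image_open : forall a, open (chart a @` chart_dom a);
  chartK : forall a m, chart_dom a m -> chart_inv a (chart a m) = m;
  chart_continuous : forall a m, chart_dom a m -> {for m, continuous (chart a)};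
  chart_inv_continuous : forall a x, (chart a @` chart_dom a) x ->
    {for x, continuous (chart_inv a)};
  chart_transition : forall a b (j : 'I_n),
    Coo (chart a @` (chart_dom a `&` chart_dom b))
        (fun x => chart b (chart_inv a x) 0 j) }.

Section SmoothFunctions.
Variables (R : realType) (n : nat) (M : manifold R n).

Definition smooth_on (W : set M) (f : M -> R) : Prop :=
  forall a : chart_idx M,
    Coo (chart a @` (chart_dom a `&` W)) (fun x => f (chart_inv a x)).

Lemma chart_image_openI (W : set M) a : open W ->
  open (chart a @` (chart_dom a `&` W)).
Proof.
move=> oW.
have -> : chart a @` (chart_dom a `&` W) =
    (chart a @` chart_dom a) `&` (chart_inv a @^-1` W).
  apply/seteqP; split => [_ [m [am Wm] <-]|_ [[m am <-]]] /=.
    by split; [exists m|rewrite chartK].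
  by rewrite chartK // => Wm; exists m.
rewrite openE => x [Ax Wx]; apply: filterI.
  by apply: open_nbhs_nbhs; split => //; exact: chart_image_open.
by apply: (chart_inv_continuous Ax); exact: open_nbhs_nbhs.
Qed.

Lemma smooth_on_cst W c : open W -> smooth_on W (fun=> c).
Proof. by move=> oW a k; apply: Ck_cst; exact: chart_image_openI. Qed.

Lemma smooth_onD W f g : open W -> smooth_on W f -> smooth_on W g ->
  smooth_on W (fun m => f m + g m).
Proof.
move=> oW sf sg a k; apply: CkD; first exact: chart_image_openI.
  exact: (sf a k).
exact: (sg a k).
Qed.

Lemma smooth_onM W f g : open W -> smooth_on W f -> smooth_on W g ->
  smooth_on W (fun m => f m * g m).
Proof.
move=> oW sf sg a k; apply: CkM; first exact: chart_image_openI.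
  exact: (sf a k).
exact: (sg a k).
Qed.

Lemma smooth_onS (V W : set M) f : open V -> V `<=` W ->
  smooth_on W f -> smooth_on V f.
Proof.
move=> oV VW sf a k; have := sf a k.
have sub : chart a @` (chart_dom a `&` V) `<=` chart a @` (chart_dom a `&` W).
  by move=> _ [m [am Vm] <-]; exists m => //; split => //; exact: VW.
move: sub; move: (_ @` (_ `&` V)) (_ @` (_ `&` W)) => A B.
elim: k (fun x => _) => [|k IH] h AB /= [ch dh]; split => //;
  try by move=> x /AB; exact: ch.
by move=> v; have [dv Cv] := dh v; split; [move=> x /AB; exact: dv|exact: IH].
Qed.

Definition smooth : {pred M -> R} := [pred f | `[< smooth_on setT f >]].

Lemma smooth_subring : subring_closed smooth.
Proof.
have op := @openT M.
split.
- by rewrite inE; exact: smooth_on_cst.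
- move=> f g; rewrite !inE => sf sg.
  have -> : f - g = (fun m => f m + (fun=> - 1) m * g m).
    by apply/funext => m /=; rewrite mulN1r.
  by apply: smooth_onD => //; apply: smooth_onM => //; exact: smooth_on_cst.
- by move=> f g; rewrite !inE => sf sg; exact: smooth_onM.
Qed.

(** The ring C^oo(M); a [pzRingType] since M may be empty. *)
Record smooth_fun := SmoothFun {
  smooth_val :> M -> R;
  smoothP : smooth_val \in smooth }.

HB.instance Definition _ := [isSub for smooth_val].
HB.instance Definition _ := [Choice of smooth_fun by <:].
HB.instance Definition _ :=
  GRing.SubChoice_isSubComPzRing.Build (M -> R) smooth smooth_fun smooth_subring.

Lemma smooth_cst_subproof (c : R) : (fun=> c) \in smooth.
Proof. by rewrite inE; apply: smooth_on_cst; exact: openT. Qed.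

Definition smooth_cst (c : R) : smooth_fun := SmoothFun (smooth_cst_subproof c).

Lemma smooth_cst1 : smooth_cst 1 = 1.
Proof. exact: val_inj. Qed.

Definition Rlinear (U V : lmodType smooth_fun) (h : U -> V) : Prop :=
  forall (c : R) (u v : U),
    h (smooth_cst c *: u + v) = smooth_cst c *: h u + h v.

(** Vector fields, as derivations of C^oo(M). *)
Definition is_vector_field (X : smooth_fun -> smooth_fun) : Prop :=
  (forall (c : R) f g, X (smooth_cst c * f + g) = smooth_cst c * X f + X g) /\
  (forall f g, X (f * g) = f * X g + X f * g).

End SmoothFunctions.

(** Smooth real vector bundles over M: a family of fibres, with local
    trivializations [triv b] over an open cover whose transition maps are
    smooth; the rank is locally constant.  [triv b m] is meaningful only for
    [m] in [triv_dom b]. *)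
Record vbundle (R : realType) (n : nat) (M : manifold R n) := VBundle {
  fibre :> M -> lmodType R;
  triv_idx : Type;
  triv_dom : triv_idx -> set M;
  triv_rank : triv_idx -> nat;
  triv : forall b m, {linear fibre m -> 'rV[R]_(triv_rank b)};
  triv_inv : forall b m, 'rV[R]_(triv_rank b) -> fibre m;
  triv_dom_open : forall b, open (triv_dom b);
  triv_cover : forall m, exists b, triv_dom b m;
  trivK : forall b m, triv_dom b m -> cancel (triv b m) (@triv_inv b m);
  triv_invK : forall b m, triv_dom b m -> cancel (@triv_inv b m) (triv b m);
  triv_transition : forall b c (v : 'rV[R]_(triv_rank b)) (j : 'I_(triv_rank c)),
    smooth_on (triv_dom b `&` triv_dom c)
              (fun m => triv c m (triv_inv m v) 0 j) }.

Section Sections.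
Variables (R : realType) (n : nat) (M : manifold R n) (E : vbundle M).

Definition smooth_section (s : forall m, E m) : Prop :=
  forall (b : triv_idx E) (j : 'I_(triv_rank b)),
    smooth_on (triv_dom b) (fun m => triv b m (s m) 0 j).

(** The C^oo(M)-module of smooth sections of E. *)
Record sections := Section_ {
  section_val :> forall m, E m;
  section_smooth : smooth_section section_val }.

HB.instance Definition _ := gen_eqMixin sections.
HB.instance Definition _ := gen_choiceMixin sections.

Lemma section_ext (s t : sections) : (forall m, s m = t m) -> s = t.
Proof.
move=> st; have e : section_val s = section_val t.
  exact: functional_extensionality_dep.
case: s t e {st} => [s ss] [t st] /= e; case: _ / e st => st.
by congr Section_; exact: Prop_irrelevance.
Qed.

Lemma section0_subproof : smooth_section (fun m => 0 : E m).
Proof.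
move=> b j; have -> : (fun m => triv b m (0 : E m) 0 j) = fun=> 0.
  by apply/funext => m; rewrite linear0 mxE.
by apply: smooth_on_cst; exact: triv_dom_open.
Qed.

Lemma sectionD_subproof (s t : sections) : smooth_section (fun m => s m + t m).
Proof.
move=> b j; have -> : (fun m => triv b m (s m + t m) 0 j) =
    fun m => triv b m (s m) 0 j + triv b m (t m) 0 j.
  by apply/funext => m; rewrite linearD mxE.
by apply: smooth_onD; [exact: triv_dom_open|exact: section_smooth..].
Qed.

Lemma sectionZ_subproof (f : smooth_fun M) (s : sections) :
  smooth_section (fun m => f m *: s m).
Proof.
move=> b j; have -> : (fun m => triv b m (f m *: s m) 0 j) =
    fun m => f m * triv b m (s m) 0 j.
  by apply/funext => m; rewrite linearZ mxE.
apply: smooth_onM; [exact: triv_dom_open| |exact: section_smooth].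
apply: smooth_onS (@subsetT _ _) _; first exact: triv_dom_open.
by have := smoothP f; rewrite inE.
Qed.

Definition section0 := Section_ section0_subproof.
Definition sectionD s t := Section_ (sectionD_subproof s t).
Definition sectionZ f s := Section_ (sectionZ_subproof f s).
Definition sectionN s := sectionZ (smooth_cst M (- 1)) s.

Lemma sectionDA : associative sectionD.
Proof. by move=> s t u; apply: section_ext => m /=; rewrite addrA. Qed.
Lemma sectionDC : commutative sectionD.
Proof. by move=> s t; apply: section_ext => m /=; rewrite addrC. Qed.
Lemma section0D : left_id section0 sectionD.
Proof. by move=> s; apply: section_ext => m /=; rewrite add0r. Qed.
Lemma sectionND : left_inverse section0 sectionN sectionD.
Proof. by move=> s; apply: section_ext => m /=; rewrite scaleN1r addNr. Qed.

HB.instance Definition _ :=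
  GRing.isZmodule.Build sections sectionDA sectionDC section0D sectionND.

Lemma sectionZA f g s : sectionZ f (sectionZ g s) = sectionZ (f * g) s.
Proof. by apply: section_ext => m /=; rewrite scalerA. Qed.
Lemma section1Z : left_id 1 sectionZ.
Proof. by move=> s; apply: section_ext => m /=; rewrite scale1r. Qed.
Lemma sectionZDr : right_distributive sectionZ +%R.
Proof. by move=> f s t; apply: section_ext => m /=; rewrite scalerDr. Qed.
Lemma sectionZDl s : {morph sectionZ^~ s : f g / f + g}.
Proof. by move=> f g; apply: section_ext => m /=; rewrite scalerDl. Qed.

HB.instance Definition _ := GRing.Zmodule_isLmodule.Build (smooth_fun M)
  sections sectionZA section1Z sectionZDr sectionZDl.

End Sections.

(** A vector bundle over M enters below through its C^oo(M)-module of smooth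
    sections: sections of Hom(A, B), or of Hom(/\^k A, B), are the
    C^oo(M)-linear, or alternating C^oo(M)-multilinear, maps on sections, and
    bundle maps over the identity of M are the C^oo(M)-linear maps. *)
Section GaugeAlgebroid.
Variables (R : realType) (n : nat) (M : manifold R n) (E : vbundle M).
Local Notation GE := (sections E).

Definition has_symbol (d : GE -> GE) (X : smooth_fun M -> smooth_fun M) : Prop :=
  is_vector_field X /\ forall f u, d (f *: u) = f *: d u + X f *: u.

Definition gauge_pred : {pred GE -> GE} :=
  [pred d | `[< Rlinear d /\ exists X, has_symbol d X >]].

Lemma gauge_submod : submod_closed gauge_pred.
Proof.
split.
  rewrite inE; split; first by move=> c u v /=; rewrite scaler0 addr0.
  exists (fun=> 0); split; last by move=> f u /=; rewrite scaler0 scale0r addr0.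
  by split=> [c f g|f g]; rewrite ?mulr0 ?mul0r addr0.
move=> h d e; rewrite !inE => -[ld [X [[X1 X2] dX]]] [le [Y [[Y1 Y2] eY]]].
split.
  move=> c u v /=; rewrite !fctE ld le !scalerDr !scalerA mulrC -!addrA.
  by congr (_ + _); rewrite addrCA.
exists (fun f => h * X f + Y f); split; first split.
- by move=> c f g; rewrite X1 Y1; ring.
- by move=> f g; rewrite X2 Y2; ring.
move=> f u /=; rewrite !fctE dX eY !scalerDr !scalerA scalerDl mulrC -!addrA.
by congr (_ + _); rewrite addrCA.
Qed.

HB.instance Definition _ :=
  GRing.isSubmodClosed.Build _ _ gauge_pred gauge_submod.

(** Sections of the gauge Lie algebroid DE. *)
Record gauge := Gauge {
  gauge_val :> GE -> GE;
  gaugeP : gauge_val \in gauge_pred }.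

HB.instance Definition _ := [isSub for gauge_val].
HB.instance Definition _ := [Choice of gauge by <:].
HB.instance Definition _ := [SubChoice_isSubLmodule of gauge by <:].

Implicit Types (d r t : gauge).

Lemma gaugeE d : Rlinear d /\ exists X, has_symbol d X.
Proof. by have := gaugeP d; rewrite inE. Qed.

Lemma gauge_add d u v : d (u + v) = d u + d v.
Proof.
have [ld _] := gaugeE d.
by have := ld 1 u v; rewrite smooth_cst1 !scale1r.
Qed.

Lemma gauge0 d : d 0 = 0.
Proof. by apply: (addrI (d 0)); rewrite -gauge_add !addr0. Qed.

Lemma gauge_id_subproof : (id : GE -> GE) \in gauge_pred.
Proof.
rewrite inE; split => //; exists (fun=> 0); split; last first.
  by move=> f u; rewrite scale0r addr0.
by split=> [c f g|f g]; rewrite ?mulr0 ?mul0r addr0.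
Qed.

Definition gauge_id : gauge := Gauge gauge_id_subproof.

Lemma gauge_bracket_subproof d r :
  (fun u => d (r u) - r (d u)) \in gauge_pred.
Proof.
have [ld [X [[X1 X2] dX]]] := gaugeE d.
have [lr [Y [[Y1 Y2] rY]]] := gaugeE r.
rewrite inE; split.
  by move=> c u v; rewrite lr ld ld lr scalerBr opprD addrACA.
have lin0 (Z : smooth_fun M -> smooth_fun M) :
    (forall (c : R) f g, Z (smooth_cst M c * f + g) = smooth_cst M c * Z f + Z g) ->
    forall f g, Z (f + g) = Z f + Z g.
  move=> Z1 f g; have := Z1 1 f g.
  by rewrite smooth_cst1 !mul1r.
exists (fun f => X (Y f) - Y (X f)); split; first split.
- by move=> c f g; rewrite Y1 X1 X1 Y1; ring.
- by move=> f g; rewrite Y2 X2 !(lin0 X) // !(lin0 Y) // !X2 !Y2; ring.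
move=> f u; rewrite rY dX !gauge_add !dX !rY scalerBr scalerBl !opprD.
have aux (a b c e g h : GE) :
    a + b + (c + e) + (- g - c + (- b - h)) = a - g + (e - h).
  rewrite [c + e]addrC [a + b + _]addrACA [- b - h]addrC [- g - c + _]addrACA.
  by rewrite [LHS]addrACA -[- c - b]opprD [c + b]addrC subrr addr0 addrACA.
exact: aux.
Qed.

Definition gauge_bracket d r : gauge := Gauge (gauge_bracket_subproof d r).

(** Sections of gl(E) = End(E), as those sections of DE with zero symbol. *)
Definition is_gl d : Prop := forall f u, d (f *: u) = f *: d u.

Definition is_jet (mu : gauge -> GE) : Prop :=
  linear mu /\ forall Psi, is_gl Psi -> mu Psi = Psi (mu gauge_id).

Definition jet_pred : {pred gauge -> GE} := [pred mu | `[< is_jet mu >]].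

Lemma jet_submod : submod_closed jet_pred.
Proof.
split.
  rewrite inE; split; first by move=> f d r /=; rewrite scaler0 addr0.
  by move=> Psi _; rewrite gauge0.
move=> h mu nu; rewrite !inE => -[lmu jmu] [lnu jnu]; split.
  move=> f d r /=; rewrite !fctE lmu lnu !scalerDr !scalerA mulrC -!addrA.
  by congr (_ + _); rewrite addrCA.
by move=> Psi gPsi; rewrite !fctE jmu // jnu // gauge_add gPsi.
Qed.

HB.instance Definition _ := GRing.isSubmodClosed.Build _ _ jet_pred jet_submod.

(** Sections of the jet bundle JE, inside the sections of Hom(DE, E). *)
Record jets := Jet {
  jet_val :> gauge -> GE;
  jetP : jet_val \in jet_pred }.

HB.instance Definition _ := [isSub for jet_val].
HB.instance Definition _ := [Choice of jets by <:].
HB.instance Definition _ := [SubChoice_isSubLmodule of jets by <:].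

Implicit Types (mu nu : jets).

Lemma jetE mu : is_jet mu.
Proof. by have := jetP mu; rewrite inE. Qed.

Lemma jet_d_subproof (u : GE) : (fun d : gauge => d u) \in jet_pred.
Proof. by rewrite inE; split. Qed.

Definition jet_d (u : GE) : jets := Jet (jet_d_subproof u).

Lemma lie_jet_subproof d mu :
  (fun d' => d (mu d') - mu (gauge_bracket d d')) \in jet_pred.
Proof.
have [lmu jmu] := jetE mu; have [_ [X [_ dX]]] := gaugeE d.
have muD a b : mu (a + b) = mu a + mu b by have := lmu 1 a b; rewrite !scale1r.
have mu0 : mu 0 = 0 by apply: (addrI (mu 0)); rewrite -muD !addr0.
rewrite inE; split.
  move=> f a b.
  have -> : gauge_bracket d (f *: a + b) =
      f *: gauge_bracket d a + (X f *: a + gauge_bracket d b).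
    apply: val_inj; apply/funext => u.
    rewrite /= gauge_add dX scalerBr opprD -!addrA; congr (_ + _).
    by rewrite [RHS]addrCA; congr (_ + _); rewrite addrCA.
  rewrite lmu gauge_add dX lmu (muD (X f *: a)).
  have -> : mu (X f *: a) = X f *: mu a.
    by rewrite -[_ *: a]addr0 lmu mu0 addr0.
  rewrite scalerBr !opprD -!addrA; congr (_ + _).
  rewrite addrCA [X in _ + X]addrCA [X f *: mu a + _]addrA subrr add0r.
  by rewrite addrCA.
move=> Psi gPsi; rewrite jmu //.
have mubr : mu (gauge_bracket d Psi) = gauge_bracket d Psi (mu gauge_id).
  rewrite jmu // => f u /=; rewrite gPsi !dX gauge_add !gPsi scalerBr.
  by rewrite opprD addrACA subrr addr0.
have -> : gauge_bracket d gauge_id = 0.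
  by apply: val_inj; apply/funext => u /=; rewrite subrr.
by rewrite mu0 mubr /= subr0 opprB addrCA subrr addr0.
Qed.

Definition lie_jet d mu : jets := Jet (lie_jet_subproof d mu).

(** Sections of Hom(/\^3 DE, E)_JE. *)
Definition is_form3 (W : gauge -> gauge -> gauge -> GE) : Prop :=
  [/\ (forall r t, linear (fun d => W d r t)),
      (forall d t, linear (fun r => W d r t)),
      (forall d r, linear (fun t => W d r t)) &
      (forall d r, [/\ W d d r = 0, W d r r = 0 & W d r d = 0])].

Record form3_JE := Form3JE {
  form3_val :> gauge -> gauge -> gauge -> GE;
  form3P : is_form3 form3_val;
  form3_jet : forall d r, is_jet (form3_val d r) }.

Implicit Types (Theta : form3_JE).

(** The Chevalley-Eilenberg coboundary of a 3-form. *)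
Definition ce_d (W : gauge -> gauge -> gauge -> GE) (d0 d1 d2 d3 : gauge) : GE :=
  d0 (W d1 d2 d3) - d1 (W d0 d2 d3) + d2 (W d0 d1 d3) - d3 (W d0 d1 d2)
  - W (gauge_bracket d0 d1) d2 d3 + W (gauge_bracket d0 d2) d1 d3
  - W (gauge_bracket d0 d3) d1 d2 - W (gauge_bracket d1 d2) d0 d3
  + W (gauge_bracket d1 d3) d0 d2 - W (gauge_bracket d2 d3) d0 d1.

Lemma form3_contract_subproof Theta d r : Theta d r \in jet_pred.
Proof. by rewrite inE; exact: form3_jet. Qed.

(** Theta(d /\ r), a section of JE. *)
Definition form3_contract Theta d r : jets := Jet (form3_contract_subproof Theta d r).

(** The structure maps of an E-Courant algebroid, on sections; the axioms are
    not part of the record. *)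
Record courant_data := CourantData {
  courant_car :> lmodType (smooth_fun M);
  courant_pairing : courant_car -> courant_car -> GE;
  courant_bracket : courant_car -> courant_car -> courant_car;
  courant_anchor : courant_car -> gauge }.

Definition courant_isomorphic (A B : courant_data) : Prop :=
  exists phi : {linear A -> B},
    [/\ bijective phi,
        (forall a b, courant_pairing (phi a) (phi b) = courant_pairing a b),
        (forall a b, phi (courant_bracket a b) =
                     courant_bracket (phi a) (phi b)) &
        (forall a, courant_anchor (phi a) = courant_anchor a)].

Definition omni_pairing (a b : gauge * jets) : GE :=
  smooth_cst M 2^-1 *: (b.2 a.1 + a.2 b.1).

Definition omni_bracket (a b : gauge * jets) : gauge * jets :=
  (gauge_bracket a.1 b.1,
   lie_jet a.1 b.2 - lie_jet b.1 a.2 + jet_d (a.2 b.1)).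

Definition twisted_bracket Theta (a b : gauge * jets) : gauge * jets :=
  omni_bracket a b + (0, form3_contract Theta a.1 b.1).

Definition omni_lie : courant_data :=
  @CourantData (gauge * jets)%type omni_pairing omni_bracket fst.

Definition twisted_omni_lie Theta : courant_data :=
  @CourantData (gauge * jets)%type omni_pairing (twisted_bracket Theta) fst.

End GaugeAlgebroid.

(* Main.v *)
From HB Require Import structures.
Require Import Defs.
From mathcomp Require Import all_boot all_order all_algebra.
From mathcomp Require Import all_classical all_reals.
Import GRing.Theory.
Local Open Scope ring_scope.

(** The identity of E is a section of the gauge algebroid: it corresponds
    to the Euler vector field of E.  It is central for the bracket and acts on E as the
    identity, so the Lie derivative along it is the identity on every E-valued
    form, and Cartan's formula says that contraction with it is a contracting
    homotopy of the complex of E-valued forms.  Hence a closed Theta is the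
    coboundary of the 2-form B(d, r) = Theta(Id, d, r) (lemma
    [closed_form3_exact]).  Since Theta takes its values in jets, so does B, in
    the sense that B(d, _) is a section of JE for each d.

    A 2-form B of this kind shears the omni-Lie algebroid by
    d + mu |-> d + mu + B(d, _).  As for the B-field transformations of exact
    Courant algebroids, skewness of B makes this shear an isometry, and it
    changes the bracket exactly by the coboundary of B (lemma
    [coboundary_twist_isomorphic]).  So the twist by Theta = dB is undone. *)

Lemma alternating_skew (K : pzRingType) (U V : lmodType K) (F : U -> U -> V) :
  (forall y, linear (fun x => F x y)) -> (forall x, linear (F x)) ->
  (forall x, F x x = 0) -> forall x y, F x y = - F y x.
Proof.
move=> linl linr alt x y; apply/eqP; rewrite -addr_eq0; apply/eqP.
have addl a b c : F (a + b) c = F a c + F b c.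
  by have := linl c 1 a b; rewrite !scale1r.
have addr a b c : F c (a + b) = F c a + F c b.
  by have := linr c 1 a b; rewrite !scale1r.
by have := alt (x + y); rewrite addl !addr !alt add0r addr0.
Qed.

Section BField.
Context {R : realType} {n : nat} {M : manifold R n} {E : vbundle M}.
Implicit Types (d r t : gauge E) (B : {linear gauge E -> jets E}).

Lemma jet_ext (mu nu : jets E) : (forall d, mu d = nu d) -> mu = nu.
Proof. by move=> e; apply: val_inj; apply/funext. Qed.

Definition bshear B (a : gauge E * jets E) : gauge E * jets E :=
  (a.1, a.2 + B a.1).

Lemma bshear_linear B : linear (bshear B).
Proof.
move=> f a b; rewrite /bshear; congr pair.
by rewrite /= linearP scalerDr addrACA.
Qed.

HB.instance Definition _ B :=
  GRing.isLinear.Build (smooth_fun M) (gauge E * jets E)%type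
    (gauge E * jets E)%type _ (bshear B) (bshear_linear B).

Lemma bshear_bijective B : bijective (bshear B).
Proof.
exists (fun a => (a.1, a.2 - B a.1)) => -[d mu]; rewrite /bshear /=.
  by rewrite addrK.
by rewrite subrK.
Qed.

Lemma alternating_jets_skew B : (forall d, B d d = 0) ->
  forall d r, B d r = - B r d.
Proof.
move=> Balt; apply: alternating_skew => // [r f d d'|d].
  by rewrite linearP.
exact: (jetE (B d)).1.
Qed.

(** The difference between shearing before and after the standard bracket is
    L_d B(r) - L_r B(d) + d<B(d), r> - B([d, r]); by skewness of B, this is the
    Chevalley-Eilenberg coboundary of B evaluated on d and r. *)
Lemma coboundary_twist_isomorphic B (Theta : form3_JE E) :
  (forall d, B d d = 0) ->
  (forall d r t, Theta d r t =
     d (B r t) - r (B d t) + t (B d r)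
     - B (gauge_bracket d r) t + B (gauge_bracket d t) r
     - B (gauge_bracket r t) d) ->
  courant_isomorphic (twisted_omni_lie Theta) (omni_lie E).
Proof.
move=> Balt dB; have skew := alternating_jets_skew B Balt.
exists (bshear B : {linear twisted_omni_lie Theta -> omni_lie E}); split => //.
- exact: bshear_bijective.
- move=> [d mu] [r nu]; rewrite /= /omni_pairing /=; congr (_ *: _).
  by rewrite !fctE addrACA (skew d r) subrr addr0.
move=> [d mu] [r nu].
rewrite /= /twisted_bracket /omni_bracket /bshear /=.
congr pair; first by rewrite addr0.
apply: jet_ext => t; rewrite /= !fctE /= addr0 dB.
rewrite !gauge_add (skew (gauge_bracket d t)) (skew (gauge_bracket r t)).
rewrite !(opprD, opprK) !addrA.
(* The two terms B [d, r] t, of opposite signs, are moved to the end. *)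
by rewrite [LHS](ACl (1*6*2*10*3*7*4*11*5*8*9*12)) /= subrK.
Qed.

End BField.

Section Homotopy.
Context {R : realType} {n : nat} {M : manifold R n} {E : vbundle M}.
Variable Theta : form3_JE E.
Implicit Types (d r t : gauge E).

Lemma form3_skew12 d r t : Theta d r t = - Theta r d t.
Proof.
have [lin1 lin2 _ alt] := form3P Theta.
apply: (alternating_skew _ _ _ (fun d r => Theta d r t)) => x //=.
by have [] := alt x t.
Qed.

Lemma gauge_bracket_idl d : gauge_bracket (gauge_id E) d = 0.
Proof. by apply: val_inj; apply/funext => u /=; rewrite subrr. Qed.

Definition form3_contract_id : gauge E -> jets E :=
  form3_contract Theta (gauge_id E).

Lemma form3_contract_id_linear : linear form3_contract_id.
Proof.
move=> f d d'; apply: jet_ext => t.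
by have [_ lin2 _ _] := form3P Theta; exact: lin2.
Qed.

HB.instance Definition _ :=
  GRing.isLinear.Build (smooth_fun M) (gauge E) (jets E) _
    form3_contract_id form3_contract_id_linear.

(** This is dTheta(Id, d, r, t) = 0: the first term of the coboundary is
    Id (Theta(d, r, t)), and the brackets with Id vanish. *)
Lemma closed_form3_exact :
  (forall d0 d1 d2 d3, ce_d Theta d0 d1 d2 d3 = 0) ->
  forall d r t, let B := form3_contract_id in
    Theta d r t =
      d (B r t) - r (B d t) + t (B d r)
      - B (gauge_bracket d r) t + B (gauge_bracket d t) r
      - B (gauge_bracket r t) d.
Proof.
move=> closed d r t B.
have Theta0 x y : Theta 0 x y = 0.
  have [lin1 _ _ _] := form3P Theta.
  have := lin1 x y 1 0 0; rewrite !scale1r addr0 => e.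
  by apply: (addrI (Theta 0 x y)); rewrite addr0 -e.
have := closed (gauge_id E) d r t.
rewrite /ce_d !gauge_bracket_idl !Theta0 !(form3_skew12 _ (gauge_id E)) /=.
rewrite !(opprK, subr0, addr0).
by move=> e; apply/eqP; rewrite -subr_eq0 !(opprD, opprK) !addrA; apply/eqP.
Qed.

End Homotopy.

Theorem theorem4p7 (R : realType) (n : nat) (M : manifold R n) (E : vbundle M)
    (Theta : form3_JE E) :
  (forall d0 d1 d2 d3 : gauge E, ce_d Theta d0 d1 d2 d3 = 0) ->
  courant_isomorphic (twisted_omni_lie Theta) (omni_lie E).
Proof.
move=> closed.
apply: (@coboundary_twist_isomorphic _ _ _ _
          (form3_contract_id Theta : {linear gauge E -> jets E})).
  by move=> d; have [_ _ _ /(_ (gauge_id E) d)[]] := form3P Theta.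
exact: closed_form3_exact.
Qed.
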